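(* Let $M$ be an MDP, let $\phi$ be an approximate model similarity abstraction of $M$ with errors $\eta_R$ and $\eta_T$, and let inputs $|\bar S|,|A|,\epsilon,\delta,T_\epsilon$ be given, where $T_\epsilon$ is the $\epsilon$-return mixing time of the optimal policy. With probability at least $1-\delta$, the R-MAX algorithm adapted to abstraction (described in the context) will attain an expected average return of $$\mathrm{Opt}\Big(\prod\nolimits_M(\epsilon,T_\epsilon)\Big)-3\,\frac{g(\eta_T,\eta_R)}{T_\epsilon}-2\epsilon$$ within a number of steps polynomial in $|\bar S|,|A|,\frac1\epsilon,\frac1\delta,T_\epsilon$, where $$g(\eta_T,\eta_R)=T_\epsilon\eta_R+\frac{(T_\epsilon-1)T_\epsilon}{2}\,\eta_T\,|\bar S|\,R_{\max}.$$
   Context: $M=\langle S,A,T,R\rangle$ is a finite MDP with deterministic reward function $R(s,a)\in[0,R_{\max}]$, $0<R_{\max}<\infty$ ($R_{\max}$ is a known constant). $M$ is ergodic: every state is recurrent under every stationary policy. $\phi:S\to\bar S$ is surjective; $\bar s\in\bar S$ is identified with $\{s:\phi(s)=\bar s\}$; $T(\bar s'|s,a)=\sum_{s'\in\bar s'}T(s'|s,a)$. $\phi$ is an approximate model similarity abstraction with $\eta_R,\eta_T$: $\phi(s_1)=\phi(s_2)$ implies $|R(s_1,a)-R(s_2,a)|\le\eta_R$ and $|T(\bar s'|s_1,a)-T(\bar s'|s_2,a)|\le\eta_T$ for all $a\in A$, $\bar s'\in\bar S$. It is moreover assumed that all states in the same abstract state have the same reward function. Mixing time: the $\epsilon$-return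 mixing time of a policy $\pi$ is the minimum number of steps needed to guarantee that its expected undiscounted average return (from any start state) is within $\epsilon$ of its long-run expected average return. $\prod_M(\epsilon,T_\epsilon)$ is the set of policies of $M$ whose $\epsilon$-return mixing time is $T_\epsilon$ (i.e. at most $T_\epsilon$), and $\mathrm{Opt}(\prod_M(\epsilon,T_\epsilon))$ is the optimal expected $T_\epsilon$-step undiscounted average return achievable by such policies (where the value of a policy is its minimum over start states). R-MAX from abstracted observations (inputs $\phi,\delta,\epsilon,T_\epsilon$): initialise an abstract model $\bar M_Y=\langle\bar S,A,\bar T_Y,\bar R_Y\rangle$ with $\bar T_Y(\bar s|\bar s,a)=1$, $\bar R_Y(\bar s,a)=R_{\max}$, and an empty list $\bar Y_{\bar s,a}$ for every $(\bar s,a)$. Select a number $m$ of samples required for an abstract state-action pair to become ''known'' (chosen as a suitable polynomial function of the inputs). While some pair has fewer than $m$ samples: compute an optimal $T_\epsilon$-step policy $\bar\pi$ in $\bar M_Y$ for the current abstract state and follow it for $T_\epsilon$ time steps in $M$ (taking action $\bar\pi(\phi(s))$ in state $s$); after each transition from $s$ to $s'$ with reward $r$ under action $a$, with $\bar s=\phi(s)$, if $|\bar Y_{\bar s,a}|<m$ append $\phi(s')$ to $\bar Y_{\bar s,a}$; if now $|\bar Y_{\bar s,a}|=m$, set $\bar T_Y(\bar s'|\bar s,a)=\frac1m\sum_{i=1}^m\mathbb 1\{\bar Y^{(i)}_{\bar s,a}=\bar s'\}$ for all $\bar s'$, set $\bar R_Y(\bar s,a)=r$, and stop following the current policy (recompute).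 Once all pairs are known, compute an optimal policy for $\bar M_Y$ and run it indefinitely. The guarantee means: with probability at least $1-\delta$, within a polynomial number of steps, an average return at least the stated value is obtained. *)

(* Defs.v *)
From HB Require Import structures.
From mathcomp Require Import all_boot all_order all_algebra.
From mathcomp Require Import all_classical all_reals all_analysis.
From mathcomp Require mpoly.
Set Implicit Arguments.
Unset Strict Implicit.
Unset Printing Implicit Defensive.
Import Order.TTheory GRing.Theory Num.Theory.
Import numFieldNormedType.Exports.
Local Open Scope classical_set_scope.
Local Open Scope ring_scope.

Record mdp (R : realType) (S A : finType) := MDP {
  trans : S -> A -> S -> R;
  rew : S -> A -> R }.

Definition is_mdp (R : realType) (S A : finType) (Rmax : R)
    (M : mdp R S A) : Prop :=
  [/\ forall s a s', 0 <= trans M s a s',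
      forall s a, \sum_s' trans M s a s' = 1
    & forall s a, 0 <= rew M s a <= Rmax].

(* [pi s a] is the probability of taking [a] in [s]. *)
Definition is_policy (R : realType) (S A : finType)
    (pi : S -> A -> R) : Prop :=
  (forall s a, 0 <= pi s a) /\ (forall s, \sum_a pi s a = 1).

(* Undiscounted [n]-step return from [s], where the decision rule [pi k] is
   used at step [k]. *)
Fixpoint expected_return (R : realType) (S A : finType) (M : mdp R S A)
    (pi : nat -> S -> A -> R) (n : nat) (s : S) : R :=
  if n is n'.+1 then
    \sum_a pi 0%N s a *
      (rew M s a +
       \sum_s' trans M s a s' *
               expected_return M (fun k => pi k.+1) n' s')
  else 0.

Definition average_return (R : realType) (S A : finType) (M : mdp R S A)
    (pi : S -> A -> R) (n : nat) (s : S) : R :=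
  expected_return M (fun=> pi) n s / n%:R.

(* The limit exists for every stationary policy, since [S] is finite; it is
   taken per start state, so no irreducibility is presupposed. *)
Definition long_run_return (R : realType) (S A : finType) (M : mdp R S A)
    (pi : S -> A -> R) (s : S) : R :=
  limn (fun n => average_return M pi n s).

Definition chain (R : realType) (S A : finType) (M : mdp R S A)
    (pi : S -> A -> R) (s s' : S) : R :=
  \sum_a pi s a * trans M s a s'.

(* Probability that the chain [P] started at [x] is not at [s] at any of the
   times 1, ..., n. *)
Fixpoint avoid_prob (R : realType) (S : finType) (P : S -> S -> R)
    (s : S) (n : nat) (x : S) : R :=
  if n is n'.+1 then \sum_(y | y != s) P x y * avoid_prob P s n' y else 1.

Definition recurrent (R : realType) (S : finType) (P : S -> S -> R)
    (s : S) : Prop :=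
  (fun n => avoid_prob P s n s) @ \oo --> (0 : R).

Definition ergodic (R : realType) (S A : finType) (M : mdp R S A) : Prop :=
  forall pi : S -> A -> R, is_policy pi -> forall s, recurrent (chain M pi) s.

(* The deviation bound must persist from time [T] on, for all start states. *)
Definition mixed_after (R : realType) (S A : finType) (M : mdp R S A)
    (eps : R) (pi : S -> A -> R) (T : nat) : Prop :=
  forall n s, (T <= n)%N ->
    `|average_return M pi n s - long_run_return M pi s| <= eps.

(* A 0-step average is meaningless, so [T] ranges over positive integers. *)
Definition is_mixing_time (R : realType) (S A : finType) (M : mdp R S A)
    (eps : R) (pi : S -> A -> R) (T : nat) : Prop :=
  [/\ (0 < T)%N, mixed_after M eps pi T
    & forall T', (0 < T')%N -> mixed_after M eps pi T' -> (T <= T')%N].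

Definition mixing_policies (R : realType) (S A : finType) (M : mdp R S A)
    (eps : R) (T : nat) : set (S -> A -> R) :=
  [set pi | is_policy pi /\
            exists2 T', (T' <= T)%N & is_mixing_time M eps pi T'].

(* The infimum over start states is a minimum, since [S] is finite. *)
Definition Opt (R : realType) (S A : finType) (M : mdp R S A)
    (eps : R) (T : nat) : R :=
  sup [set inf (range (average_return M pi T))
      | pi in mixing_policies M eps T].

Definition optimal_policy (R : realType) (S A : finType) (M : mdp R S A)
    (pi : S -> A -> R) : Prop :=
  is_policy pi /\
  forall pi', is_policy pi' ->
    forall s, long_run_return M pi' s <= long_run_return M pi s.

Definition abs_trans (R : realType) (S Sb A : finType) (M : mdp R S A)
    (phi : S -> Sb) (s : S) (a : A) (sb : Sb) : R :=
  \sum_(s' | phi s' == sb) trans M s a s'.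

Definition approx_model_similarity (R : realType) (S Sb A : finType)
    (M : mdp R S A) (phi : S -> Sb) (etaR etaT : R) : Prop :=
  forall s1 s2, phi s1 = phi s2 -> forall a,
    `|rew M s1 a - rew M s2 a| <= etaR /\
    forall sb, `|abs_trans M phi s1 a sb - abs_trans M phi s2 a sb| <= etaT.

(* Deterministic finite-horizon policies: the action depends on the step
   index and on the state; only the indices below the horizon matter. *)
Definition step_policy (S A : finType) := nat -> S -> A.

Definition step_return (R : realType) (S A : finType) (M : mdp R S A)
    (T : nat) (f : step_policy S A) (s : S) : R :=
  expected_return M (fun k x a => (a == f k x)%:R) T s.

Definition optimal_step_policy (R : realType) (S A : finType)
    (M : mdp R S A) (T : nat) (s : S) (f : step_policy S A) : Prop :=
  forall f' : step_policy S A, step_return M T f' s <= step_return M T f s.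

(* The memory of the learner. [clock] is the number of steps for which the
   current policy [plan] has been followed. *)
Record agent (R : realType) (Sb A : finType) := Agent {
  model : mdp R Sb A;
  samples : Sb -> A -> seq Sb;
  plan : step_policy Sb A;
  clock : nat }.

(* [solve B x] is the [T]-step policy computed in the model [B] for the
   current abstract state [x] while some pair is unknown; [solve_final B] is
   the policy computed once the model [B] is complete; it is run forever,
   restarting at step index 0 every [T] steps, because an optimal policy for
   a horizon [T] is in general not stationary. *)
Definition choose_plan (R : realType) (Sb A : finType) (m : nat)
    (solve : mdp R Sb A -> Sb -> step_policy Sb A)
    (solve_final : mdp R Sb A -> step_policy Sb A)
    (B : mdp R Sb A) (Y : Sb -> A -> seq Sb) (x : Sb) : step_policy Sb A :=
  if [exists sb, [exists a, (size (Y sb a) < m)%N]] then solve B x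
  else solve_final B.

Definition init_agent (R : realType) (Sb A : finType) (Rmax : R) (m : nat)
    (solve : mdp R Sb A -> Sb -> step_policy Sb A)
    (solve_final : mdp R Sb A -> step_policy Sb A) (x0 : Sb) : agent R Sb A :=
  let B := MDP (fun x _ y => (y == x)%:R) (fun _ _ => Rmax) in
  let Y := fun _ _ => [::] in
  Agent B Y (choose_plan m solve solve_final B Y x0) 0.

Definition act (R : realType) (Sb A : finType) (g : agent R Sb A)
    (x : Sb) : A :=
  plan g (clock g) x.

(* Update after taking action [a] in abstract state [x], receiving reward [r]
   and observing the abstract successor [y]. A pair becomes known only once,
   at the step at which its sample list reaches length [m]; that interrupts
   the current policy. *)
Definition update_agent (R : realType) (Sb A : finType) (m T : nat)
    (solve : mdp R Sb A -> Sb -> step_policy Sb A)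
    (solve_final : mdp R Sb A -> step_policy Sb A)
    (g : agent R Sb A) (x : Sb) (a : A) (r : R) (y : Sb) : agent R Sb A :=
  let here x' a' := (x' == x) && (a' == a) in
  let grows := (size (samples g x a) < m)%N in
  let Yxa := if grows then rcons (samples g x a) y else samples g x a in
  let Y := fun x' a' => if here x' a' then Yxa else samples g x' a' in
  let becomes_known := grows && (size Yxa == m) in
  let B :=
    if becomes_known then
      MDP (fun x' a' y' => if here x' a' then (count_mem y' Yxa)%:R / m%:R
                           else trans (model g) x' a' y')
          (fun x' a' => if here x' a' then r else rew (model g) x' a')
    else model g in
  if becomes_known || ((clock g).+1 == T) then
    Agent B Y (choose_plan m solve solve_final B Y y) 0
  else Agent B Y (plan g) (clock g).+1.

(* The probability that the interaction of the learner [g] with [M], started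
   at [s], visits exactly the states [p] next. *)
Fixpoint path_prob (R : realType) (S Sb A : finType) (M : mdp R S A)
    (phi : S -> Sb)
    (upd : agent R Sb A -> Sb -> A -> R -> Sb -> agent R Sb A)
    (g : agent R Sb A) (s : S) (p : seq S) : R :=
  if p is s' :: p' then
    let a := act g (phi s) in
    trans M s a s' *
    path_prob M phi upd (upd g (phi s) a (rew M s a) (phi s')) s' p'
  else 1.

Fixpoint path_return (R : realType) (S Sb A : finType) (M : mdp R S A)
    (phi : S -> Sb)
    (upd : agent R Sb A -> Sb -> A -> R -> Sb -> agent R Sb A)
    (g : agent R Sb A) (s : S) (p : seq S) : R :=
  if p is s' :: p' then
    let a := act g (phi s) in
    rew M s a +
    path_return M phi upd (upd g (phi s) a (rew M s a) (phi s')) s' p'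
  else 0.

(* Probability that the average reward collected by the algorithm during its
   first [N] steps from [s0] is at least [v]. *)
Definition rmax_attains (R : realType) (S Sb A : finType) (M : mdp R S A)
    (phi : S -> Sb) (Rmax : R) (m T : nat)
    (solve : mdp R Sb A -> Sb -> step_policy Sb A)
    (solve_final : mdp R Sb A -> step_policy Sb A)
    (s0 : S) (N : nat) (v : R) : R :=
  let upd := update_agent m T solve solve_final in
  let g0 := init_agent Rmax m solve solve_final (phi s0) in
  \sum_(p : N.-tuple S | v <= path_return M phi upd g0 s0 p / N%:R)
     path_prob M phi upd g0 s0 p.

(* Value of a polynomial in five variables at
   (|Sb|, |A|, 1/eps, 1/delta, T). *)
Definition poly_inputs (R : realType) (P : mpoly.mpoly 5 R)
    (nS nA : nat) (eps delta : R) (T : nat) : R :=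
  mpoly.meval
    (tnth [tuple nS%:R; nA%:R; eps^-1; delta^-1; T%:R]) P.

Definition sample_size (R : realType) (P : mpoly.mpoly 5 R)
    (nS nA : nat) (eps delta : R) (T : nat) : nat :=
  `|Num.ceil (poly_inputs P nS nA eps delta T)|%N.

Definition abs_error (R : realType) (nS T : nat) (Rmax etaT etaR : R) : R :=
  T%:R * etaR + (T%:R - 1) * T%:R / 2 * etaT * nS%:R * Rmax.

(* Main.v *)
Require Import Defs.
From HB Require Import structures.
From mathcomp Require Import all_boot all_order all_algebra.
From mathcomp Require Import all_classical all_reals all_analysis.
From mathcomp Require mpoly.
From mathcomp Require Import ring lra.
Set Implicit Arguments.
Unset Strict Implicit.
Unset Printing Implicit Defensive.
Import Order.TTheory GRing.Theory Num.Theory.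
Import numFieldNormedType.Exports.
Local Open Scope classical_set_scope.
Local Open Scope ring_scope.

(** The samples of an abstract pair come from different ground states, but each
    of their conditional laws lies in a window of width [etaT]; Chebyshev's
    inequality for martingales puts the empirical law within [etaT + eps1] of
    the law of every ground state of the pair, outside an event of probability
    [delta / 2].  While all estimates are accurate, the model is optimistic, so
    every new plan promises nearly the optimal [T]-step return of M, and on
    known pairs the plan keeps this promise in expectation up to the same
    modelling error; unknown pairs are visited at most [m |Sb| |A|] times in
    total.  Hence the collected reward, plus the value still promised by the
    current plan, plus a bonus for every sample taken, minus [v] per step, is a
    submartingale with bounded increments, to which Chebyshev's inequality
    applies again.  Both deviation bounds are carried by one function of the
    learner's state ([shortfall_bound]), so that they follow by induction on
    the number of steps.  Mixing enters only through the fact that [Opt] is at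
    most the best [T]-step average return from any state. *)

(** * Averages under finite distributions and a one-sided quadratic potential *)

Section WeightedSums.
Context {R : realType} {I : finType} {p : I -> R}.
Hypotheses (p_ge0 : forall i, 0 <= p i) (p_sum1 : \sum_i p i = 1).

Lemma wsum_cst (c : R) : \sum_i p i * c = c.
Proof. by rewrite -mulr_suml p_sum1 mul1r. Qed.

Lemma ler_wsum (f g : I -> R) :
  (forall i, f i <= g i) -> \sum_i p i * f i <= \sum_i p i * g i.
Proof. by move=> fg; apply: ler_sum => i _; apply: ler_wpM2l. Qed.

Lemma wsum_le (f : I -> R) (b : R) :
  (forall i, f i <= b) -> \sum_i p i * f i <= b.
Proof. by move=> fb; rewrite -[leRHS]wsum_cst; apply: ler_wsum. Qed.

Lemma wsum_ge (f : I -> R) (b : R) :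
  (forall i, b <= f i) -> b <= \sum_i p i * f i.
Proof. by move=> fb; rewrite -[leLHS]wsum_cst; apply: ler_wsum. Qed.

(** The potential of both Chebyshev arguments; it is one-sided so that favourable deviations cost
    nothing. *)
Definition sqpos (x : R) : R := Num.max x 0 ^+ 2.

(** With [w] the positive part of [u], the new potential is at most [(w - d i) ^+ 2]; the cross term
    averages to a nonpositive number because [w] and the drift are nonnegative. *)
Lemma sqpos_drift (d : I -> R) (u c : R) :
  0 <= \sum_i p i * d i -> (forall i, `|d i| <= c) ->
  \sum_i p i * sqpos (u - d i) <= sqpos u + c ^+ 2.
Proof.
move=> drift dc; set w := Num.max u 0.
have w_ge0 : 0 <= w by rewrite /w le_max lexx orbT.
have step i : sqpos (u - d i) <= sqpos u + c ^+ 2 - 2 * w * d i.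
  have dc2 : d i ^+ 2 <= c ^+ 2.
    rewrite -real_normK ?num_real //; apply: lerXn2r; rewrite ?nnegrE //.
    exact: le_trans (dc i).
  rewrite /sqpos -/w; apply: (@le_trans _ _ ((w - d i) ^+ 2)); last by nra.
  have uw : u <= w by rewrite /w le_max lexx.
  rewrite {1}/Num.max; case: ifP => udi; first by rewrite expr0n /= sqr_ge0.
  apply: lerXn2r; rewrite ?nnegrE; lra.
apply: (le_trans (ler_wsum step)).
under eq_bigr do rewrite mulrBr mulrCA.
rewrite sumrB wsum_cst -mulr_sumr.
have := mulr_ge0 (mulr_ge0 (ler0n R 2) w_ge0) drift; lra.
Qed.

End WeightedSums.

Lemma sqpos_ge0 (R : realType) (x : R) : 0 <= sqpos x.
Proof. exact: sqr_ge0. Qed.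

Lemma sqpos0 (R : realType) (x : R) : x <= 0 -> sqpos x = 0.
Proof. by move=> /max_idPr xm; rewrite /sqpos xm expr0n. Qed.

Lemma sqpos_ge (R : realType) (x y : R) : 0 <= x -> x <= y -> x ^+ 2 <= sqpos y.
Proof.
move=> x_ge0 xy; rewrite /sqpos; apply: lerXn2r; rewrite ?nnegrE //.
  by rewrite le_max lexx orbT.
by rewrite le_max xy.
Qed.

Lemma sum_tupleS (R : realType) (S : finType) (n : nat) (P : pred (seq S))
    (F : seq S -> R) :
  \sum_(p : n.+1.-tuple S | P p) F p =
  \sum_s \sum_(p : n.-tuple S | P (s :: p)) F (s :: p).
Proof.
rewrite (reindex (fun q : S * n.-tuple S => [tuple of q.1 :: q.2])) /=; last first.
  exists (fun p : n.+1.-tuple S => (thead p, [tuple of behead p])) => /=.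
    by case=> s p _ /=; congr pair; apply: val_inj.
  by move=> p _; rewrite /= -tuple_eta.
by rewrite (pair_big_dep xpredT (fun s (p : n.-tuple S) => P (s :: p))
  (fun s (p : n.-tuple S) => F (s :: p))).
Qed.

(** * Finite-horizon returns and the benchmark [Opt] *)

Section Returns.
Context {R : realType} {S A : finType}.

Lemma expected_return_bounds (Rmax : R) (M : mdp R S A)
    (pi : nat -> S -> A -> R) (n : nat) (s : S) :
  is_mdp Rmax M -> (forall k, is_policy (pi k)) ->
  0 <= expected_return M pi n s <= n%:R * Rmax.
Proof.
case=> T_ge0 T_sum1 R_bnd; elim: n pi s => [|n IHn] pi s pi_pol /=.
  by rewrite mul0r lexx.
have [pi_ge0 pi_sum1] := pi_pol 0%N.
have step a : 0 <= rew M s a + \sum_s' trans M s a s' *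
    expected_return M (fun k => pi k.+1) n s' <= n.+1%:R * Rmax.
  have /andP[r_ge0 r_le] := R_bnd s a.
  have ER s' := IHn (fun k => pi k.+1) s' (fun k => pi_pol k.+1).
  have V_ge0 := wsum_ge (T_ge0 s a) (T_sum1 s a)
    (fun s' => proj1 (andP (ER s'))).
  have V_le := wsum_le (T_ge0 s a) (T_sum1 s a)
    (fun s' => proj2 (andP (ER s'))).
  by rewrite addr_ge0 //= -natr1 mulrDl mul1r addrC lerD.
apply/andP; split.
  by apply: wsum_ge => // a; have /andP[] := step a.
by apply: wsum_le => // a; have /andP[] := step a.
Qed.

Lemma deterministic_policy (f : S -> A) :
  is_policy (fun s a => (a == f s)%:R : R).
Proof.
split=> [s a|s]; first exact: ler0n.
rewrite (bigD1 (f s)) //= eqxx big1 ?addr0 // => a /negbTE->; by [].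
Qed.

Lemma step_return_bounds (Rmax : R) (B : mdp R S A) n f s :
  is_mdp Rmax B -> 0 <= step_return B n f s <= n%:R * Rmax.
Proof.
move=> B_mdp; apply: expected_return_bounds => // k.
exact: (deterministic_policy (f k)).
Qed.

Lemma step_returnS (B : mdp R S A) n f s :
  step_return B n.+1 f s = rew B s (f 0%N s) +
    \sum_s' trans B s (f 0%N s) s' * step_return B n (fun k => f k.+1) s'.
Proof.
rewrite /step_return /= (bigD1 (f 0%N s)) //= eqxx mul1r [X in _ + X = _]big1 ?addr0 //.
by move=> a /negbTE->; rewrite mul0r.
Qed.

Lemma Opt_le (M : mdp R S A) (Rmax eps b : R) (T : nat) (pi0 : S -> A -> R)
    (s : S) :
  is_mdp Rmax M -> mixing_policies M eps T pi0 ->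
  (forall pi, is_policy pi -> expected_return M (fun=> pi) T s <= b) ->
  Opt M eps T <= b / T%:R.
Proof.
move=> M_mdp pi0_mix le_b; apply: ge_sup.
  (* Bounding a supremum from above needs a nonempty set; [pi0] supplies a member. *)
  by exists (inf (range (average_return M pi0 T))), pi0.
move=> _ [pi [pi_pol _] <-].
apply: (@le_trans _ _ (average_return M pi T s)).
  apply: ge_inf; last by exists s.
  exists 0 => _ [s' _ <-]; apply: divr_ge0 => //.
  by have /andP[] := expected_return_bounds T s' M_mdp (fun=> pi_pol).
by rewrite /average_return ler_wpM2r ?invr_ge0 ?le_b.
Qed.

End Returns.

Lemma sum_count_mem (I : finType) (r : seq I) :
  (\sum_i count_mem i r)%N = size r.
Proof.
elim: r => [|j r IHr] /=; first by rewrite big1.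
rewrite big_split /= IHr (bigD1 j) //= eqxx big1 // => i /negbTE.
by rewrite eq_sym => ->.
Qed.

(** * The learner and its model *)

Section Learner.
Context {R : realType} {S Sb A : finType}.
Variables (M : mdp R S A) (phi : S -> Sb) (Rmax : R) (m T : nat).
Variables (solve : mdp R Sb A -> Sb -> step_policy Sb A).
Variables (solve_final : mdp R Sb A -> step_policy Sb A).
Hypotheses (Rmax_gt0 : 0 < Rmax) (m_gt0 : (0 < m)%N) (T_gt0 : (0 < T)%N).
Hypothesis M_mdp : is_mdp Rmax M.
Hypothesis phi_surj : forall x, exists s, phi s = x.
Hypothesis rew_phi :
  forall s1 s2 a, phi s1 = phi s2 -> rew M s1 a = rew M s2 a.

Local Notation update := (update_agent m T solve solve_final).
Local Notation known g x a := (m <= size (samples g x a))%N.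
Local Notation next g s s' :=
  (update g (phi s) (act g (phi s)) (rew M s (act g (phi s))) (phi s')).

Lemma samples_update (g : agent R Sb A) x a r y x' a' :
  samples (update g x a r y) x' a' =
  if [&& x' == x, a' == a & ~~ known g x a] then rcons (samples g x a) y
  else samples g x' a'.
Proof.
rewrite /update_agent -ltnNge; set b := (_ || _); case: b => /=;
  by case: eqP => [->|] //=; case: eqP => [->|] //=; case: ltnP.
Qed.

Lemma update_known (g : agent R Sb A) x a r y : known g x a ->
  update g x a r y =
  if (clock g).+1 == T then
    Agent (model g) (samples g)
      (choose_plan m solve solve_final (model g) (samples g) y) 0
  else Agent (model g) (samples g) (plan g) (clock g).+1.
Proof.
move=> kn; rewrite /update_agent ltnNge kn /=.
have -> : (fun x' a' => if (x' == x) && (a' == a) then samples g x a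
    else samples g x' a') = samples g.
  apply/funext => x'; apply/funext => a'.
  by case: eqP => [->|] //=; case: eqP => [->|].
by [].
Qed.

(** The model is a function of the samples. Its reward clause runs over ground states because [M]
    has no reward on [Sb]; this is consistent by [rew_phi]. *)
Record wf_agent (g : agent R Sb A) : Prop := WfAgent {
  wf_clock : (clock g < T)%N;
  wf_size : forall x a, (size (samples g x a) <= m)%N;
  wf_trans : forall x a y, trans (model g) x a y =
    if known g x a then (count_mem y (samples g x a))%:R / m%:R
    else (y == x)%:R;
  wf_rew : forall s a, rew (model g) (phi s) a =
    if known g (phi s) a then rew M s a else Rmax }.

Lemma wf_init x : wf_agent (init_agent Rmax m solve solve_final x).
Proof. by split=> //= *; rewrite leqNgt m_gt0. Qed.

Lemma wf_update (g : agent R Sb A) s a y :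
  wf_agent g -> wf_agent (update g (phi s) a (rew M s a) y).
Proof.
case=> g_clock g_size g_trans g_rew; split.
- rewrite /update_agent; set b := (X in X || _); case: b => //=.
  by case: eqP => //= /eqP; rewrite neq_ltn => /orP[//|]; rewrite ltnNge g_clock.
- move=> x' a'; rewrite samples_update; case: ifP => // /and3P[_ _].
  by rewrite -ltnNge size_rcons.
- move=> x' a' y'; rewrite samples_update /update_agent -!ltnNge.
  set b := (_ || _) => /=.
  rewrite (fun_if (@model R Sb A)) /= if_same.
  case: ltnP => [unk|kn] /=; last by rewrite !andbF g_trans.
  rewrite !andbT size_rcons; case: eqP => [full|nfull] /=.
    case: (boolP (_ && _)) => [/andP[/eqP ? /eqP ?]|_]; last exact: g_trans.
    subst x' a'.
    by rewrite size_rcons full leqnn.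
  (* The list has grown but is still shorter than [m]: the pair stays unknown and keeps its
     self-loop. *)
  rewrite g_trans; case: (boolP (_ && _)) => [/andP[/eqP-> /eqP->]|//].
  rewrite size_rcons [in LHS]leqNgt unk /= leqNgt ltn_neqAle unk andbT.
  by move/eqP: nfull => ->.
- move=> s' a'; rewrite samples_update /update_agent -!ltnNge.
  set b := (_ || _) => /=.
  rewrite (fun_if (@model R Sb A)) /= if_same.
  case: ltnP => [unk|kn] /=; last by rewrite !andbF g_rew.
  rewrite !andbT size_rcons; case: eqP => [full|nfull] /=.
    case: (boolP (_ && _)) => [/andP[/eqP ss' /eqP ?]|_]; last exact: g_rew.
    subst a'.
    by rewrite size_rcons full leqnn; apply: rew_phi.
  rewrite g_rew; case: (boolP (_ && _)) => [/andP[/eqP-> /eqP->]|//].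
  rewrite size_rcons [in LHS]leqNgt unk /= leqNgt ltn_neqAle unk andbT.
  by move/eqP: nfull => ->.
Qed.

Lemma wf_model (g : agent R Sb A) : wf_agent g -> is_mdp Rmax (model g).
Proof.
case=> _ g_size g_trans g_rew; have [_ _ R_bnd] := M_mdp; split=> [x a y|x a|x a].
- by rewrite g_trans; case: ifP => _; rewrite ?divr_ge0.
- under eq_bigr do rewrite g_trans.
  case: (leqP m) => [kn|_]; last first.
    rewrite (bigD1 x) //= eqxx big1 ?addr0 // => y /negbTE->; by [].
  rewrite -mulr_suml -natr_sum sum_count_mem.
  have -> : size (samples g x a) = m by apply/eqP; rewrite eqn_leq g_size.
  by rewrite divff // pnatr_eq0 -lt0n.
- have [s <-] := phi_surj x; rewrite g_rew; case: ifP => _ //.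
  by rewrite (ltW Rmax_gt0) lexx.
Qed.

Lemma sum_trans_phi s a (V : Sb -> R) :
  \sum_s' trans M s a s' * V (phi s') = \sum_y abs_trans M phi s a y * V y.
Proof.
rewrite (partition_big phi xpredT) //=; apply: eq_bigr => y _.
by rewrite mulr_suml; apply: eq_bigr => s' /eqP->.
Qed.

(** * Probabilities over paths *)

Lemma path_prob_ge0 g s p : 0 <= path_prob M phi update g s p.
Proof.
have [T_ge0 _ _] := M_mdp.
by elim: p g s => //= s' p IHp g s; rewrite mulr_ge0.
Qed.

Lemma path_return_ge0 g s p : 0 <= path_return M phi update g s p.
Proof.
have [_ _ R_bnd] := M_mdp.
elim: p g s => //= s' p IHp g s; rewrite addr_ge0 //.
by have /andP[] := R_bnd s (act g (phi s)).
Qed.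

Lemma path_prob_sum n g s :
  \sum_(p : n.-tuple S) path_prob M phi update g s p = 1.
Proof.
have [_ T_sum1 _] := M_mdp; elim: n g s => [|n IHn] g s.
  by rewrite (big_pred1 [tuple]) // => p; apply/esym/eqP/val_inj; case: p => -[].
rewrite (sum_tupleS n xpredT) /=.
under eq_bigr do rewrite -mulr_sumr IHn mulr1; exact: T_sum1.
Qed.

(** Totals are used instead of averages so that splitting off one step merely lowers the threshold
    by the reward received. *)
Definition shortfall_prob (n : nat) g s (w : R) : R :=
  \sum_(p : n.-tuple S | path_return M phi update g s p < w)
    path_prob M phi update g s p.

Lemma shortfall_le1 n g s w : shortfall_prob n g s w <= 1.
Proof.
rewrite -(path_prob_sum n g s) [leRHS](bigID (fun p : n.-tuple S =>
  path_return M phi update g s p < w)) /= lerDl.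
by apply: sumr_ge0 => *; apply: path_prob_ge0.
Qed.

Lemma shortfallS n g s w :
  shortfall_prob n.+1 g s w = \sum_s' trans M s (act g (phi s)) s' *
    shortfall_prob n (next g s s') s' (w - rew M s (act g (phi s))).
Proof.
rewrite /shortfall_prob (sum_tupleS n
  (fun p => path_return M phi update g s p < w)) /=.
apply: eq_bigr => s' _; rewrite mulr_sumr.
by apply: eq_bigl => p; rewrite ltrBrDl.
Qed.

Lemma rmax_attains_ge (N : nat) s0 (val w : R) :
  (0 < N)%N -> N%:R * val <= w ->
  1 - shortfall_prob N (init_agent Rmax m solve solve_final (phi s0)) s0 w <=
  rmax_attains M phi Rmax m T solve solve_final s0 N val.
Proof.
move=> N_gt0 val_w; rewrite /rmax_attains /=.
set g0 := init_agent _ _ _ _ _.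
rewrite -[X in X - _](path_prob_sum N g0 s0) (bigID (fun p : N.-tuple S =>
  path_return M phi update g0 s0 p < w)) /= addrAC subrr add0r.
rewrite [leLHS]big_mkcond [leRHS]big_mkcond /=; apply: ler_sum => p _.
rewrite -leNgt; case: ifP => [w_le|_]; last by case: ifP => // _; exact: path_prob_ge0.
by rewrite ler_pdivlMr ?ltr0n // mulrC (le_trans val_w w_le).
Qed.

(** * Accurate models and optimism *)

Section Accuracy.
Variable th : R.

(** One estimate is compared with every ground state of its class; while no pair is known, the
    condition holds vacuously. *)
Definition accurate (g : agent R Sb A) :=
  forall s a, known g (phi s) a ->
  forall y, `|trans (model g) (phi s) a y - abs_trans M phi s a y| <= th.

Lemma accurate_expectation (g : agent R Sb A) s a (V : Sb -> R) (b : R) :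
  accurate g -> known g (phi s) a -> (forall y, 0 <= V y <= b) ->
  `|\sum_s' trans M s a s' * V (phi s') -
    \sum_y trans (model g) (phi s) a y * V y| <= #|Sb|%:R * th * b.
Proof.
move=> acc kn Vb; rewrite sum_trans_phi -sumrB.
apply: le_trans (ler_norm_sum _ _ _) _.
have -> : #|Sb|%:R * th * b = \sum_(y : Sb) th * b.
  by rewrite sumr_const -[RHS]mulr_natl mulrA.
apply: ler_sum => y _; have /andP[V_ge0 V_le] := Vb y.
by rewrite -mulrBl normrM distrC (ger0_norm V_ge0) ler_pM // acc.
Qed.

(** A value over [k] remaining steps is at most [k%:R * Rmax], so by [accurate_expectation]
    replacing [M] by the model in one step costs [kap * k%:R]; over a horizon [n] this sums to
    [kap * tri n]. *)
Local Notation kap := (#|Sb|%:R * th * Rmax).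
Local Notation tri n := (n%:R * (n%:R - 1) / 2 : R).

Hypothesis th_ge0 : 0 <= th.

Lemma kap_ge0 : 0 <= kap.
Proof. by rewrite !mulr_ge0 // ltW. Qed.

Lemma tri_ge0 n : 0 <= tri n.
Proof.
rewrite divr_ge0 //; case: n => [|n]; first by rewrite mul0r.
by rewrite -natr1 addrK mulr_ge0.
Qed.

(* The first conjunct is what makes the induction work: in a state with an
   unknown pair, modelled as a self-loop with maximal reward, the greedy plan
   gets the largest possible value. *)
Lemma optimism (g : agent R Sb A) (pi : S -> A -> R) (n : nat) :
  wf_agent g -> accurate g -> is_policy pi ->
  exists f : step_policy Sb A, forall x,
    (forall a, ~~ known g x a -> n%:R * Rmax <= step_return (model g) n f x) /\
    (forall s, phi s = x -> expected_return M (fun=> pi) n s <=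
      step_return (model g) n f x + kap * tri n).
Proof.
move=> g_wf g_acc pi_pol; have g_mdp := wf_model g_wf.
have [pi_ge0 pi_sum1] := pi_pol; have [T_ge0 T_sum1 R_bnd] := M_mdp.
elim: n => [|n [f IHn]].
  by exists (plan g) => x; split=> *; rewrite /step_return /= !mul0r // mulr0 addr0.
pose Q x a := rew (model g) x a +
  \sum_y trans (model g) x a y * step_return (model g) n f y.
(* [act g x] only witnesses that [A] is inhabited. *)
pose best x := [arg max_(a > act g x) Q x a]%O.
have bestP x a : Q x a <= Q x (best x).
  by rewrite /best; case: arg_maxP => // b _; apply.
exists (fun k x => if k is k'.+1 then f k' x else best x) => x.
have retE : step_return (model g) n.+1
  (fun k x => if k is k'.+1 then f k' x else best x) x = Q x (best x).
  by rewrite step_returnS.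
have unknownQ a : ~~ known g x a -> n.+1%:R * Rmax <= Q x a.
  move=> unk; have [s phi_s] := phi_surj x.
  rewrite /Q -{1}phi_s (wf_rew g_wf) phi_s (negbTE unk) (bigD1 x) //=.
  rewrite (wf_trans g_wf) (negbTE unk) eqxx mul1r big1 ?addr0; last first.
    by move=> y /negbTE yx; rewrite (wf_trans g_wf) (negbTE unk) yx mul0r.
  by rewrite -(natr1 n) mulrDl mul1r addrC lerD2l; have [/(_ a unk)] := IHn x.
split=> [a unk|s phi_s]; rewrite retE; first exact: le_trans (unknownQ a unk) (bestP x a).
rewrite /=; apply: wsum_le => // a.
apply: (@le_trans _ _ (Q x a + kap * tri n.+1)); last by rewrite lerD2r.
(* An unknown action already promises [n.+1%:R * Rmax], which no return in [M] exceeds. *)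
case: (boolP (known g x a)) => [kn|unk]; last first.
  apply: (@le_trans _ _ (n.+1%:R * Rmax)); last first.
    by rewrite -[leLHS]addr0 lerD ?unknownQ // mulr_ge0 ?kap_ge0 ?tri_ge0.
  rewrite -natr1 mulrDl mul1r addrC lerD //.
    apply: wsum_le => // s'.
    by have /andP[] := expected_return_bounds n s' M_mdp (fun=> pi_pol).
  by have /andP[] := R_bnd s a.
subst x; rewrite /Q (wf_rew g_wf) kn -addrA lerD2l.
apply: (@le_trans _ _ (\sum_s' trans M s a s' *
    (step_return (model g) n f (phi s') + kap * tri n))).
  by apply: ler_wsum => // s'; have [_ ->] := IHn (phi s').
under eq_bigr do rewrite mulrDr.
rewrite big_split /= (wsum_cst (T_sum1 s a)).
have := accurate_expectation g_acc kn
  (fun y => step_return_bounds n f y g_mdp).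
rewrite ler_norml => /andP[_]; rewrite lerBlDl => err.
apply: le_trans (lerD err (lexx _)) _.
rewrite -addrA lerD2l -(natr1 n); lra.
Qed.

(** Either solver returns a plan that is optimal in the model, hence at least as good there as the
    witness of [optimism]. *)
Lemma restart_value (g : agent R Sb A) (pi : S -> A -> R) x s :
  (forall B y, is_mdp Rmax B -> optimal_step_policy B T y (solve B y)) ->
  (forall B y, is_mdp Rmax B -> optimal_step_policy B T y (solve_final B)) ->
  wf_agent g -> accurate g -> is_policy pi -> phi s = x ->
  expected_return M (fun=> pi) T s <= step_return (model g) T
    (choose_plan m solve solve_final (model g) (samples g) x) x + kap * tri T.
Proof.
move=> solveP solve_finalP g_wf g_acc pi_pol phi_s.
have [f /(_ x)[_ /(_ s phi_s)/le_trans]] := optimism T g_wf g_acc pi_pol.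
apply; rewrite lerD2r /choose_plan.
by case: ifP => _; [apply: solveP | apply: solve_finalP]; apply: wf_model.
Qed.

(** * The value still promised by the current plan *)

Variable v : R.

(* Lower bound on what the current plan still collects in M in excess of the
   rate [v] before its horizon is exhausted: [kap * tri n] is the modelling
   error accumulated over [n] steps. *)
Definition slack (g : agent R Sb A) (x : Sb) : R :=
  let n := (T - clock g)%N in
  step_return (model g) n (fun k => plan g (k + clock g)%N) x
  - kap * tri n - n%:R * v.

(** Says that a plan freshly chosen in any abstract state starts with nonnegative [slack]. *)
Definition optimistic (g : agent R Sb A) :=
  forall x, T%:R * v + kap * tri T <= step_return (model g) T
    (choose_plan m solve solve_final (model g) (samples g) x) x.

(** A known pair causes no interruption. If the horizon ends, the old slack is the reward minus [v]
    and the new plan starts with nonnegative slack. Otherwise the same plan goes on, and the model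
    error of this step is the decrease of [kap * tri n]. *)
Lemma slack_known (g : agent R Sb A) s :
  wf_agent g -> accurate g -> optimistic g ->
  known g (phi s) (act g (phi s)) ->
  slack g (phi s) <= \sum_s' trans M s (act g (phi s)) s' *
    (rew M s (act g (phi s)) - v + slack (next g s s') (phi s')).
Proof.
move=> g_wf g_acc g_opt kn; have [T_ge0 T_sum1 R_bnd] := M_mdp.
have [k Tk] : exists k, (T - clock g = k.+1)%N.
  by exists (T - clock g).-1; rewrite prednK // subn_gt0 (wf_clock g_wf).
rewrite {1}/slack Tk step_returnS /= -/(act g (phi s)).
set a := act g (phi s) in kn *.
rewrite (wf_rew g_wf) kn.
have [/eqP end_ep|/eqP cont] := boolP ((clock g).+1 == T).
  have k0 : k = 0%N by move: Tk; rewrite -end_ep subSnn => -[].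
  subst k; rewrite big1 => [|y _]; last by rewrite /step_return /= mulr0.
  apply: wsum_ge => // s'.
  rewrite update_known // end_ep eqxx /slack /= subn0.
  have -> : (fun j => choose_plan m solve solve_final (model g) (samples g)
      (phi s') (j + 0)%N) = choose_plan m solve solve_final (model g) (samples g)
      (phi s') by apply/funext => j /=; rewrite addn0.
  have := g_opt (phi s'); lra.
have nextE s' : slack (next g s s') (phi s') =
    step_return (model g) k (fun j => plan g (j + (clock g).+1)%N) (phi s')
    - kap * tri k - k%:R * v.
  by rewrite update_known // (negbTE (introN eqP cont)) /slack /= subnS Tk.
rewrite (eq_bigr (fun s' => trans M s a s' *
   ((rew M s a - v - kap * tri k - k%:R * v) +
    step_return (model g) k (fun j => plan g (j + (clock g).+1)%N) (phi s'))));
  last by move=> s' _; rewrite nextE; congr *%R; lra.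
under [leRHS]eq_bigr do rewrite mulrDr.
rewrite big_split /= (wsum_cst (T_sum1 s a)).
have -> : (fun j => plan g (j.+1 + clock g)%N) = (fun j => plan g (j + (clock g).+1)%N).
  by apply/funext => j /=; rewrite addnS.
have := accurate_expectation g_acc kn (fun y => step_return_bounds k
  (fun j => plan g (j + (clock g).+1)%N) y (wf_model g_wf)).
rewrite ler_norml => /andP[+ _]; rewrite -(natr1 k); lra.
Qed.

Hypotheses (v_gt0 : 0 < v) (v_le : v + kap * (T%:R - 1) <= Rmax).

(** The subtracted terms are at most [n%:R * (v + kap * (n%:R - 1))], which [v_le] bounds by
    [n%:R * Rmax]. *)
Lemma slack_bounds (g : agent R Sb A) x :
  wf_agent g -> - (2 * T%:R * Rmax) <= slack g x <= T%:R * Rmax.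
Proof.
move=> g_wf; rewrite /slack; set n := (T - clock g)%N.
have n_le : n%:R <= T%:R :> R by rewrite ler_nat leq_subr.
have n_ge1 : 1 <= n%:R :> R by rewrite ler1n subn_gt0 (wf_clock g_wf).
have /andP[ret_ge0 ret_le] := step_return_bounds n
  (fun k => plan g (k + clock g)%N) x (wf_model g_wf).
have kt_ge0 := mulr_ge0 kap_ge0 (tri_ge0 n).
have nv_ge0 : 0 <= n%:R * v by rewrite mulr_ge0 // ltW.
have nR_le : n%:R * Rmax <= T%:R * Rmax by rewrite ler_wpM2r // ltW.
have kn_le : kap * (n%:R - 1) <= kap * (T%:R - 1).
  by rewrite ler_wpM2l ?kap_ge0 // lerB.
have kn_ge0 : 0 <= kap * (n%:R - 1) by rewrite mulr_ge0 ?kap_ge0 ?subr_ge0.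
have vR : v + kap * (n%:R - 1) <= Rmax by apply: le_trans v_le; rewrite lerD2l.
have := ler_wpM2l (ler0n R n) vR; have := mulr_ge0 (ler0n R n) kn_ge0.
move: kt_ge0 nv_ge0 => *.
apply/andP; split; lra.
Qed.

(** * Deviation of empirical frequencies from a window of probabilities *)

Section Deviation.
Variables (lo hi : Sb -> A -> Sb -> R) (eps1 : R).
Hypotheses (eps1_gt0 : 0 < eps1).
Hypothesis lo_ge0 : forall x a y, 0 <= lo x a y.
Hypothesis hi_le1 : forall x a y, hi x a y <= 1.
Hypothesis lo_hi : forall s a y,
  lo (phi s) a y <= abs_trans M phi s a y <= hi (phi s) a y.
Hypothesis hi_lo : forall x a y, hi x a y - lo x a y + eps1 <= th.

(* A sample changes the expectation of each [sqpos] by at most 1; the last term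
   compensates for this, so that [dev] is a supermartingale. *)
Definition pair_dev (x : Sb) (a : A) (Y : seq Sb) : R :=
  \sum_y (sqpos ((count_mem y Y)%:R - (size Y)%:R * hi x a y) +
          sqpos ((size Y)%:R * lo x a y - (count_mem y Y)%:R))
  + (m%:R - (size Y)%:R) * (2 * #|Sb|%:R).

Definition dev (g : agent R Sb A) : R :=
  \sum_x \sum_a pair_dev x a (samples g x a).

Definition nsamples (g : agent R Sb A) : nat :=
  (\sum_x \sum_a size (samples g x a))%N.

Lemma sum_trans_hit s a y :
  \sum_s' trans M s a s' * (phi s' == y)%:R = abs_trans M phi s a y.
Proof.
rewrite /abs_trans [RHS]big_mkcond; apply: eq_bigr => s' _.
by case: ifP; rewrite ?mulr1 ?mulr0.
Qed.

(** Whichever ground state of the class is visited, the next sample equals [y] with probability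
    between [lo] and [hi], so [sqpos_drift] applies with [c = 1] to both one-sided deviations; no
    independence or common law is needed. *)
Lemma pair_dev_step s a Y :
  \sum_s' trans M s a s' * pair_dev (phi s) a (rcons Y (phi s')) <=
  pair_dev (phi s) a Y.
Proof.
have [T_ge0 T_sum1 _] := M_mdp.
rewrite /pair_dev; under eq_bigr do rewrite mulrDr.
under eq_bigr do rewrite size_rcons.
rewrite big_split /= (wsum_cst (T_sum1 s a)).
under eq_bigr do rewrite mulr_sumr.
rewrite exchange_big /=.
have count_rcons y z : (count_mem y (rcons Y z))%:R =
    (count_mem y Y)%:R + (z == y)%:R :> R.
  by rewrite -cats1 count_cat /= addn0 natrD.
have drift_hi y : \sum_s' trans M s a s' *
    sqpos ((count_mem y (rcons Y (phi s')))%:R - (size Y).+1%:R * hi (phi s) a y)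
    <= sqpos ((count_mem y Y)%:R - (size Y)%:R * hi (phi s) a y) + 1 ^+ 2.
  rewrite (eq_bigr (fun s' => trans M s a s' * sqpos (
    ((count_mem y Y)%:R - (size Y)%:R * hi (phi s) a y) -
     (hi (phi s) a y - (phi s' == y)%:R)))); last first.
    move=> s' _; rewrite count_rcons -(natr1 (size Y)).
    by congr (_ * sqpos _); ring.
  apply: sqpos_drift => //.
    under eq_bigr do rewrite mulrBr.
    rewrite sumrB (wsum_cst (T_sum1 s a)) sum_trans_hit subr_ge0.
    by have /andP[] := lo_hi s a y.
  move=> s'; rewrite ler_norml.
  have := hi_le1 (phi s) a y; have /andP[l1 l2] := lo_hi s a y.
  have := lo_ge0 (phi s) a y; case: (phi s' == y) => /= *; lra.
have drift_lo y : \sum_s' trans M s a s' *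
    sqpos ((size Y).+1%:R * lo (phi s) a y - (count_mem y (rcons Y (phi s')))%:R)
    <= sqpos ((size Y)%:R * lo (phi s) a y - (count_mem y Y)%:R) + 1 ^+ 2.
  rewrite (eq_bigr (fun s' => trans M s a s' * sqpos (
    ((size Y)%:R * lo (phi s) a y - (count_mem y Y)%:R) -
     ((phi s' == y)%:R - lo (phi s) a y)))); last first.
    move=> s' _; rewrite count_rcons -(natr1 (size Y)).
    by congr (_ * sqpos _); ring.
  apply: sqpos_drift => //.
    under eq_bigr do rewrite mulrBr.
    rewrite sumrB (wsum_cst (T_sum1 s a)) sum_trans_hit subr_ge0.
    by have /andP[] := lo_hi s a y.
  move=> s'; rewrite ler_norml.
  have := hi_le1 (phi s) a y; have /andP[l1 l2] := lo_hi s a y.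
  have := lo_ge0 (phi s) a y; case: (phi s' == y) => /= *; lra.
apply: (@le_trans _ _ (\sum_y (
    sqpos ((count_mem y Y)%:R - (size Y)%:R * hi (phi s) a y) +
    sqpos ((size Y)%:R * lo (phi s) a y - (count_mem y Y)%:R) + 2) +
    (m%:R - (size Y).+1%:R) * (2 * #|Sb|%:R))).
  rewrite lerD2r; apply: ler_sum => y _.
  under eq_bigr do rewrite mulrDr.
  rewrite big_split /=; have := drift_hi y; have := drift_lo y; lra.
rewrite big_split /= sumr_const -[2 *+ _]mulr_natl -(natr1 (size Y)); lra.
Qed.

Lemma pair_dev_ge0 x a Y : (size Y <= m)%N -> 0 <= pair_dev x a Y.
Proof.
move=> Y_le; rewrite addr_ge0 ?sumr_ge0 //.
  by move=> y _; rewrite addr_ge0 ?sqpos_ge0.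
by rewrite mulr_ge0 ?subr_ge0 ?ler_nat ?mulr_ge0.
Qed.

(** Only the summand of the visited pair can change, and only while that pair is unknown. *)
Lemma dev_step (g : agent R Sb A) s :
  wf_agent g ->
  \sum_s' trans M s (act g (phi s)) s' * dev (next g s s') <= dev g.
Proof.
move=> g_wf; have [T_ge0 T_sum1 _] := M_mdp.
set a := act g (phi s); rewrite /dev.
under eq_bigr => s' _ do rewrite (pair_bigA _ (fun x b => pair_dev x b _)) /=.
rewrite [leRHS](pair_bigA _ (fun x b => pair_dev x b _)) /=.
have [kn|unk] := boolP (known g (phi s) a).
  apply: wsum_le => // s'; rewrite le_eqVlt; apply/orP; left; apply/eqP.
  by apply: eq_bigr => -[x b] _ /=; rewrite samples_update kn !andbF.
rewrite (eq_bigr (fun s' =>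
    trans M s a s' * pair_dev (phi s) a (rcons (samples g (phi s) a) (phi s')) +
    trans M s a s' * \sum_(q | q != (phi s, a)) pair_dev q.1 q.2 (samples g q.1 q.2)));
    last first.
  move=> s' _; rewrite -mulrDr (bigD1 (phi s, a)) //= samples_update !eqxx unk /=.
  congr (_ * (_ + _)); apply: eq_bigr => -[x b] /=; rewrite xpair_eqE => ne.
  by rewrite samples_update andbA (negbTE ne).
rewrite big_split /= (wsum_cst (T_sum1 s a)) [leRHS](bigD1 (phi s, a)) //=.
by rewrite lerD2r pair_dev_step.
Qed.

Lemma dev_ge0 g : wf_agent g -> 0 <= dev g.
Proof.
by move=> g_wf; do 2![apply: sumr_ge0 => ? _]; rewrite pair_dev_ge0 ?(wf_size g_wf).
Qed.

(** For a full list, a frequency outside the window by more than [eps1] would make a single [sqpos]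
    at least [(m%:R * eps1) ^+ 2], while all other summands of [dev] are nonnegative. *)
Lemma dev_accurate (g : agent R Sb A) :
  wf_agent g -> dev g < (m%:R * eps1) ^+ 2 -> accurate g.
Proof.
move=> g_wf dev_lt s a kn y.
have szm : size (samples g (phi s) a) = m.
  by apply/eqP; rewrite eqn_leq kn (wf_size g_wf).
have mR_gt0 : 0 < m%:R :> R by rewrite ltr0n.
have me_ge0 : 0 <= m%:R * eps1 by rewrite mulr_ge0 // ltW.
set Y := samples g (phi s) a in szm.
have term_lt : sqpos ((count_mem y Y)%:R - m%:R * hi (phi s) a y) +
    sqpos (m%:R * lo (phi s) a y - (count_mem y Y)%:R) < (m%:R * eps1) ^+ 2.
  apply: le_lt_trans dev_lt; apply: (@le_trans _ _ (pair_dev (phi s) a Y)).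
    rewrite /pair_dev szm subrr mul0r addr0 (bigD1 y) //= lerDl.
    by apply: sumr_ge0 => *; rewrite addr_ge0 ?sqpos_ge0.
  have pd_ge0 x b : 0 <= pair_dev x b (samples g x b).
    by rewrite pair_dev_ge0 ?(wf_size g_wf).
  rewrite /dev (bigD1 (phi s)) //= (bigD1 a) //= -addrA lerDl.
  by rewrite addr_ge0 // sumr_ge0 // => x _; apply: sumr_ge0.
have s1 := sqpos_ge0 ((count_mem y Y)%:R - m%:R * hi (phi s) a y).
have s2 := sqpos_ge0 (m%:R * lo (phi s) a y - (count_mem y Y)%:R).
have up : (count_mem y Y)%:R - m%:R * hi (phi s) a y <= m%:R * eps1.
  rewrite leNgt; apply/negP => /ltW /(sqpos_ge me_ge0); lra.
have down : m%:R * lo (phi s) a y - (count_mem y Y)%:R <= m%:R * eps1.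
  rewrite leNgt; apply/negP => /ltW /(sqpos_ge me_ge0); lra.
rewrite (wf_trans g_wf) kn -/Y.
set c := (count_mem y Y)%:R / m%:R : R.
have cE : (count_mem y Y)%:R = m%:R * c by rewrite mulrC divfK ?gt_eqF.
move: up down; rewrite cE -!mulrBr !ler_pM2l // => up down.
have /andP[l1 l2] := lo_hi s a y; have := hi_lo (phi s) a y.
rewrite ler_norml => *; apply/andP; split; lra.
Qed.

Lemma nsamples_step (g : agent R Sb A) s s' :
  nsamples (next g s s') =
  (nsamples g + ~~ known g (phi s) (act g (phi s)))%N.
Proof.
rewrite /nsamples !(pair_bigA _ (fun x b => size (samples _ x b))) /=.
set a := act g (phi s).
rewrite (bigD1 (phi s, a)) //= [in RHS](bigD1 (phi s, a)) //= addnAC.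
rewrite samples_update !eqxx /=; congr addn.
  by case: leqP; rewrite ?addn0 // size_rcons addn1.
apply: eq_bigr => -[x b] /=; rewrite xpair_eqE => ne.
by rewrite samples_update andbA (negbTE ne).
Qed.

Lemma nsamples_le g : wf_agent g -> (nsamples g <= #|Sb| * #|A| * m)%N.
Proof.
move=> g_wf; rewrite /nsamples pair_bigA -card_prod -sum_nat_const.
by apply: leq_sum => -[x a] _; apply: wf_size.
Qed.

Lemma dev_init x :
  dev (init_agent Rmax m solve solve_final x) = 2 * #|Sb|%:R ^+ 2 * #|A|%:R * m%:R.
Proof.
have pair_dev_nil y a : pair_dev y a [::] = m%:R * (2 * #|Sb|%:R).
  rewrite /pair_dev subr0 big1 ?add0r // => z _ /=.
  by rewrite !mul0r subrr sqpos0 // addr0.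
rewrite /dev /=; under eq_bigr do under eq_bigr do rewrite pair_dev_nil.
rewrite sumr_const -[LHS]mulr_natl sumr_const -[X in _ * X]mulr_natl; ring.
Qed.

(** * Fluctuations of the collected reward *)

Variable lam : R.
Hypothesis lam_gt0 : 0 < lam.
Hypothesis accurate_optimistic :
  forall g, wf_agent g -> accurate g -> optimistic g.

(** [C] is the bonus per sample. By [slack_bounds], the reward minus [v] plus the change of slack is
    at most [Rmax + 3 * T%:R * Rmax] in absolute value, which [C] covers; with the bonus included,
    [step_bound] suffices. *)
Local Notation C := (4 * T%:R * Rmax).
Local Notation step_bound := (8 * T%:R * Rmax).

Definition budget (g : agent R Sb A) : R :=
  (#|Sb| * #|A| * m)%:R - (nsamples g)%:R.

(* The fluctuations needed for collecting less than [w] in [n] more steps are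
   measured by this quantity; it is at least [lam] when [n = 0 < w]. *)
Definition surplus (n : nat) (g : agent R Sb A) (s : S) (w : R) : R :=
  w - n%:R * v - slack g (phi s) + C * budget g + T%:R * Rmax + lam.

(** One step lowers the surplus by [d s']. Its mean is nonnegative on a known pair by [slack_known];
    on an unknown pair the bonus [C] makes every [d s'] nonnegative. *)
Lemma surplus_step n g s w : wf_agent g -> accurate g ->
  \sum_s' trans M s (act g (phi s)) s' *
    sqpos (surplus n (next g s s') s' (w - rew M s (act g (phi s)))) <=
  sqpos (surplus n.+1 g s w) + step_bound ^+ 2.
Proof.
move=> g_wf g_acc; have [T_ge0 T_sum1 R_bnd] := M_mdp.
set a := act g (phi s).
pose d s' := rew M s a - v + slack (next g s s') (phi s') - slack g (phi s)
  + C * (~~ known g (phi s) a)%:R.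
rewrite (eq_bigr (fun s' => trans M s a s' * sqpos (surplus n.+1 g s w - d s')));
  last first.
  move=> s' _; congr (_ * sqpos _).
  rewrite /surplus /d /budget nsamples_step natrD -(natr1 n) -/a; ring.
have T_ge1 : 1 <= T%:R :> R by rewrite ler1n.
have v_pos := v_gt0.
have TR_ge : Rmax <= T%:R * Rmax by rewrite ler_peMl // ltW.
have v_R : v <= Rmax.
  apply: le_trans v_le; rewrite lerDl mulr_ge0 ?kap_ge0 // subr_ge0 //.
have /andP[r_ge0 r_le] := R_bnd s a.
have /andP[W_ge W_le] := slack_bounds (phi s) g_wf.
have W'_bnd s' := slack_bounds (phi s') (wf_update s a (phi s') g_wf).
apply: sqpos_drift => //; last first.
  move=> s'; have /andP[W'_ge W'_le] := W'_bnd s'.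
  rewrite ler_norml /d -/a; case: (known g (phi s) a) => /=;
    apply/andP; split; lra.
have [kn|unk] := boolP (known g (phi s) a).
  have := slack_known g_wf g_acc (accurate_optimistic g_wf g_acc) kn.
  rewrite -/a /d kn /= => drift.
  rewrite (eq_bigr (fun s' => trans M s a s' *
    (rew M s a - v + slack (next g s s') (phi s')) +
    trans M s a s' * - slack g (phi s))); last by move=> s' _; rewrite -/a; ring.
  by rewrite big_split /= (wsum_cst (T_sum1 s a)) subr_ge0.
apply: wsum_ge => // s'; have /andP[W'_ge W'_le] := W'_bnd s'.
rewrite /d unk /= -/a; lra.
Qed.

(* The first term bounds the probability that some known pair ends up with an
   inaccurate estimate; the second one is Chebyshev's inequality for the
   fluctuations as long as all estimates are accurate. *)
Lemma shortfall_bound n g s w : wf_agent g ->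
  shortfall_prob n g s w <= dev g / (m%:R * eps1) ^+ 2 +
    (sqpos (surplus n g s w) + n%:R * step_bound ^+ 2) / lam ^+ 2.
Proof.
have [T_ge0 T_sum1 R_bnd] := M_mdp.
have K_gt0 : 0 < (m%:R * eps1) ^+ 2 by rewrite exprn_gt0 // mulr_gt0 ?ltr0n.
have lam2_gt0 : 0 < lam ^+ 2 by rewrite exprn_gt0.
have dev_K_ge0 g' : wf_agent g' -> 0 <= dev g' / (m%:R * eps1) ^+ 2.
  by move=> g'_wf; rewrite divr_ge0 ?dev_ge0 // ltW.
have rest_ge0 k u : 0 <= (sqpos u + k%:R * step_bound ^+ 2) / lam ^+ 2.
  by rewrite divr_ge0 ?(ltW lam2_gt0) // addr_ge0 ?sqpos_ge0 // mulr_ge0 ?sqr_ge0.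
elim: n g s w => [|n IHn] g s w g_wf.
  have [w_le|w_gt] := leP w 0.
    rewrite /shortfall_prob big_pred0 ?addr_ge0 ?dev_K_ge0 // => p.
    by case: p => -[|//] /= _; rewrite ltNge w_le.
  apply: (le_trans (shortfall_le1 _ _ _ _)).
  rewrite -[leLHS]add0r lerD ?dev_K_ge0 // mul0r addr0 ler_pdivlMr // mul1r.
  apply: sqpos_ge; first exact: ltW.
  (* The term [T%:R * Rmax] of the surplus absorbs the slack left at the end, so the surplus is at
     least [lam]. *)
  have /andP[_ W_le] := slack_bounds (phi s) g_wf.
  have : 0 <= C * budget g.
    apply: mulr_ge0; last by rewrite subr_ge0 ler_nat nsamples_le.
    by rewrite !mulr_ge0 // ltW.
  rewrite /surplus mul0r; lra.
(* Once [dev] reaches this level, the first term alone is at least 1, so accuracy may be assumed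
   afterwards. *)
have [dev_lt|dev_ge] := ltP (dev g) ((m%:R * eps1) ^+ 2); last first.
  apply: (le_trans (shortfall_le1 _ _ _ _)).
  by rewrite -[leLHS]addr0 lerD // ler_pdivlMr // mul1r.
have g_acc := dev_accurate g_wf dev_lt.
rewrite shortfallS; apply: (le_trans (ler_wsum (T_ge0 _ _)
  (fun s' => IHn _ s' _ (wf_update s _ (phi s') g_wf)))).
set a := act g (phi s).
rewrite (eq_bigr (fun s' => trans M s a s' * dev (next g s s') /
    (m%:R * eps1) ^+ 2 +
  (trans M s a s' * sqpos (surplus n (next g s s') s' (w - rew M s a)) / lam ^+ 2 +
   trans M s a s' * (n%:R * step_bound ^+ 2 / lam ^+ 2)))); last first.
  by move=> s' _; rewrite -/a; ring.
rewrite !big_split /= -!mulr_suml T_sum1 mul1r lerD //.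
  by rewrite ler_wpM2r ?invr_ge0 ?(ltW K_gt0) // dev_step.
rewrite -mulrDl ler_wpM2r ?invr_ge0 ?(ltW lam2_gt0) //.
have := surplus_step n s w g_wf g_acc; rewrite -/a -(natr1 n); lra.
Qed.

(** The threshold [N%:R * v - 2 * lam] makes the initial surplus nonpositive: one [lam] cancels the
    [lam] in [surplus], the other pays for all bonuses and for [T%:R * Rmax]. *)
Lemma attains_bound (N : nat) (s0 : S) (val delta : R) :
  (0 < N)%N -> N%:R * val <= N%:R * v - 2 * lam ->
  C * (#|Sb| * #|A| * m)%:R + T%:R * Rmax <= lam ->
  2 * #|Sb|%:R ^+ 2 * #|A|%:R * m%:R / (m%:R * eps1) ^+ 2 +
    N%:R * step_bound ^+ 2 / lam ^+ 2 <= delta ->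
  1 - delta <= rmax_attains M phi Rmax m T solve solve_final s0 N val.
Proof.
move=> N_gt0 val_le lam_ge delta_ge.
apply: le_trans (rmax_attains_ge s0 N_gt0 val_le); rewrite lerD2l lerN2.
set g0 := init_agent _ _ _ _ _; have g0_wf : wf_agent g0 := wf_init _.
apply: le_trans (shortfall_bound _ _ _ g0_wf) _; apply: le_trans delta_ge.
rewrite /g0 dev_init lerD2l sqpos0 ?add0r // -/g0.
have g0_acc : accurate g0 by move=> s a /=; rewrite leqNgt m_gt0.
have budget0 : budget g0 = (#|Sb| * #|A| * m)%:R.
  by rewrite /budget /nsamples /= big1 ?subr0 // => x _; rewrite big1.
have slack0 : 0 <= slack g0 (phi s0).
  rewrite /slack /= subn0.
  have -> : (fun k => choose_plan m solve solve_final (model g0) (samples g0)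
    (phi s0) (k + 0)%N) = choose_plan m solve solve_final (model g0)
    (samples g0) (phi s0) by apply/funext => k /=; rewrite addn0.
  have := accurate_optimistic g0_wf g0_acc (phi s0); lra.
rewrite /surplus budget0; lra.
Qed.

Lemma attains_nonpos (N : nat) (s0 : S) (val : R) :
  (0 < N)%N -> val <= 0 ->
  1 <= rmax_attains M phi Rmax m T solve solve_final s0 N val.
Proof.
move=> N_gt0 val_le; rewrite -[leLHS](subr0 1).
have <- : shortfall_prob N (init_agent Rmax m solve solve_final (phi s0)) s0 0 = 0.
  by rewrite /shortfall_prob big_pred0 // => p; rewrite ltNge path_return_ge0.
by apply: rmax_attains_ge => //; rewrite mulr_ge0_le0.
Qed.

End Deviation.
End Accuracy.

(** * The window of transition probabilities of an abstract pair *)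

Lemma abs_trans_range s a y : 0 <= abs_trans M phi s a y <= 1.
Proof.
have [T_ge0 T_sum1 _] := M_mdp; rewrite sumr_ge0 //=.
rewrite -(T_sum1 s a) [leRHS](bigID (fun s' => phi s' == y)) /= lerDl.
exact: sumr_ge0.
Qed.

(** The window is spanned by the least and the greatest probability within the class, both attained,
    so similarity bounds its width. *)
Lemma abs_trans_window (etaR etaT : R) :
  approx_model_similarity M phi etaR etaT ->
  exists lo hi : Sb -> A -> Sb -> R,
    [/\ forall x a y, 0 <= lo x a y,
        forall x a y, hi x a y <= 1,
        forall s a y,
          lo (phi s) a y <= abs_trans M phi s a y <= hi (phi s) a y
      & forall x a y, hi x a y - lo x a y <= etaT].
Proof.
move=> phi_sim; have [rep repP] := choice phi_surj.
pose amin x a y := [arg min_(s < rep x | phi s == x) abs_trans M phi s a y]%O.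
pose amax x a y := [arg max_(s > rep x | phi s == x) abs_trans M phi s a y]%O.
have aminP x a y : phi (amin x a y) = x /\
    forall s, phi s = x -> abs_trans M phi (amin x a y) a y <= abs_trans M phi s a y.
  rewrite /amin; case: arg_minP => [|s /eqP ? s_min]; first exact/eqP.
  by split=> // s' /eqP/s_min.
have amaxP x a y : phi (amax x a y) = x /\
    forall s, phi s = x -> abs_trans M phi s a y <= abs_trans M phi (amax x a y) a y.
  rewrite /amax; case: arg_maxP => [|s /eqP ? s_max]; first exact/eqP.
  by split=> // s' /eqP/s_max.
exists (fun x a y => abs_trans M phi (amin x a y) a y),
  (fun x a y => abs_trans M phi (amax x a y) a y); split=> [x a y|x a y|s a y|x a y].
- by have /andP[] := abs_trans_range (amin x a y) a y.
- by have /andP[] := abs_trans_range (amax x a y) a y.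
- by rewrite (proj2 (aminP _ _ _)) // (proj2 (amaxP _ _ _)).
- have [pmin _] := aminP x a y; have [pmax _] := amaxP x a y.
  have [_ /(_ y)] := phi_sim _ _ (etrans pmax (esym pmin)) a.
  exact/le_trans/ler_norm.
Qed.

End Learner.

(** * Polynomial bounds *)

Lemma absz_ceil_bounds (R : realType) (x : R) :
  0 < x -> x <= (`|Num.ceil x|%N)%:R <= x + 1.
Proof.
move=> x_gt0; have c_ge0 : 0 <= Num.ceil x by rewrite -(ceil0 R) le_ceil // ltW.
have -> : (`|Num.ceil x|%N)%:R = (Num.ceil x)%:~R :> R.
  by rewrite natr_absz ger0_norm.
by rewrite ceil_ge /= -lerBlDr; have := ceilB1_lt x; rewrite intrB => /ltW.
Qed.

Section Polynomials.
Import -(notations) mpoly.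
Context {R : realType} (Rmax : R).

Local Notation X i := (mpolyX R (mnm1 (inord i : 'I_5))).

(** Solves [2 * nS ^+ 2 * nA * m / (m * eps1) ^+ 2 <= delta / 2] for [m], with
    [eps1 = eps / (T * nS * Rmax)]. *)
Definition sample_poly : mpoly 5 R :=
  mpolyC 5 (4 * Rmax ^+ 2) * X 0 ^+ 4 * X 1 * X 2 ^+ 2 * X 3 * X 4 ^+ 2.

(** With [lam = N * eps / 2], the first summand makes the fluctuation term at most [delta / 2] and
    the second makes [lam] cover the bonuses. Each added 1 accounts for a rounding:
    [sample_poly + 1] bounds [m], the last one serves [N]. *)
Definition steps_poly : mpoly 5 R :=
  mpolyC 5 512 * (mpolyC 5 (Rmax ^+ 2) * X 4 ^+ 2 * X 3 * X 2 ^+ 2) +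
  mpolyC 5 (2 * Rmax) * X 4 * X 2 *
    (4%:R * X 0 * X 1 * (sample_poly + 1) + 1) + 1.

Variables (nS nA T : nat) (eps delta : R).

Local Notation m_bound :=
  (4 * Rmax ^+ 2 * nS%:R ^+ 4 * nA%:R * eps^-1 ^+ 2 * delta^-1 * T%:R ^+ 2).

Lemma sample_polyE : poly_inputs sample_poly nS nA eps delta T = m_bound.
Proof.
rewrite /poly_inputs /sample_poly !(mevalM, rmorphXn) /= !(mevalXU, mevalC).
by rewrite !(tnth_nth 0) /= !inordK.
Qed.

Lemma steps_polyE : poly_inputs steps_poly nS nA eps delta T =
  512 * (Rmax ^+ 2 * T%:R ^+ 2 * delta^-1 * eps^-1 ^+ 2) +
  2 * Rmax * T%:R * eps^-1 * (4 * nS%:R * nA%:R * (m_bound + 1) + 1) + 1.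
Proof.
rewrite -sample_polyE /steps_poly; move: sample_poly => q.
rewrite /poly_inputs !(mevalD, mevalM, rmorphXn, rmorph1, rmorph_nat) /=.
by rewrite !(mevalXU, mevalC) !(tnth_nth 0) /= !inordK.
Qed.

End Polynomials.

(** * Choice of the constants and conclusion *)

Theorem theorem4 (R : realType) (Rmax : R) (Rmax_gt0 : 0 < Rmax) :
  exists Pm PN : mpoly.mpoly 5 R,
  forall (S Sb A : finType) (M : mdp R S A) (phi : S -> Sb)
    (etaR etaT eps delta : R) (T : nat) (piopt : S -> A -> R)
    (solve : mdp R Sb A -> Sb -> step_policy Sb A)
    (solve_final : mdp R Sb A -> step_policy Sb A) (s0 : S),
  is_mdp Rmax M ->
  ergodic M ->
  (forall sb, exists s, phi s = sb) ->
  approx_model_similarity M phi etaR etaT ->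
  (forall s1 s2 a, phi s1 = phi s2 -> rew M s1 a = rew M s2 a) ->
  0 < eps ->
  0 < delta < 1 ->
  optimal_policy M piopt ->
  is_mixing_time M eps piopt T ->
  (forall (B : mdp R Sb A) (sb : Sb), is_mdp Rmax B ->
     optimal_step_policy B T sb (solve B sb)) ->
  (forall (B : mdp R Sb A) (sb : Sb), is_mdp Rmax B ->
     optimal_step_policy B T sb (solve_final B)) ->
  let m := sample_size Pm #|Sb| #|A| eps delta T in
  (0 < m)%N /\
  exists N : nat,
    [/\ (0 < N)%N,
        N%:R <= poly_inputs PN #|Sb| #|A| eps delta T
      & 1 - delta <=
        rmax_attains M phi Rmax m T solve solve_final s0 N
          (Opt M eps T - 3 * (abs_error #|Sb| T Rmax etaT etaR / T%:R)
           - 2 * eps)].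
Proof.
exists (sample_poly Rmax), (steps_poly Rmax).
move=> S Sb A M phi etaR etaT eps delta T piopt solve solve_final s0.
move=> M_mdp _ phi_surj phi_sim rew_phi eps_gt0 /andP[delta_gt0 delta_lt1].
move=> [pi_pol _] pi_mix solveP solve_finalP m.
have T_gt0 : (0 < T)%N by case: pi_mix.
have [a0 _] : exists a : A, true.
  case: (pickP A) => [a _|noA]; first by exists a.
  have [_ /(_ s0)/eqP] := pi_pol; rewrite big_pred0 //.
  by rewrite eq_sym oner_eq0.
have nS_ge1 : 1 <= #|Sb|%:R :> R by rewrite ler1n; apply/card_gt0P; exists (phi s0).
have nA_ge1 : 1 <= #|A|%:R :> R by rewrite ler1n; apply/card_gt0P; exists a0.
have T_ge1 : 1 <= T%:R :> R by rewrite ler1n.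
have etaR_ge0 : 0 <= etaR.
  by have [+ _] := phi_sim s0 s0 erefl a0; apply: le_trans.
have etaT_ge0 : 0 <= etaT.
  by have [_ /(_ (phi s0))] := phi_sim s0 s0 erefl a0; apply: le_trans.
set nS : R := #|Sb|%:R in nS_ge1 *; set nA : R := #|A|%:R in nA_ge1 *.
set t : R := T%:R in T_ge1 *.
have nS_gt0 : 0 < nS by lra.
have nA_gt0 : 0 < nA by lra.
have t_gt0 : 0 < t by lra.
pose m_bound := 4 * Rmax ^+ 2 * nS ^+ 4 * nA * eps^-1 ^+ 2 * delta^-1 * t ^+ 2.
have m_bound_gt0 : 0 < m_bound.
  by rewrite /m_bound !mulr_gt0 ?exprn_gt0 ?invr_gt0.
have /andP[m_ge m_le] : m_bound <= m%:R <= m_bound + 1.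
  by rewrite /m /sample_size sample_polyE; apply: absz_ceil_bounds.
have m_gt0 : (0 < m)%N by rewrite -(ltr0n R) (lt_le_trans m_bound_gt0).
split=> //.
set mR : R := m%:R in m_ge m_le.
pose u := Rmax ^+ 2 * t ^+ 2 * delta^-1 * eps^-1 ^+ 2.
have u_gt0 : 0 < u by rewrite /u !mulr_gt0 ?exprn_gt0 ?invr_gt0.
pose N_bound := 512 * u +
  2 * Rmax * t * eps^-1 * (4 * nS * nA * mR + 1).
have mR_gt0 : 0 < mR by rewrite (lt_le_trans m_bound_gt0).
have N_bound_gt0 : 0 < N_bound.
  have : 0 < 2 * Rmax * t * eps^-1 * (4 * nS * nA * mR + 1).
    by rewrite !mulr_gt0 ?invr_gt0 // addr_gt0 // !mulr_gt0.
  rewrite /N_bound; lra.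
exists `|Num.ceil N_bound|%N; set N := `|_|%N.
have /andP[N_ge N_le] : N_bound <= N%:R <= N_bound + 1 := absz_ceil_bounds N_bound_gt0.
have N_gt0 : (0 < N)%N by rewrite -(ltr0n R) (lt_le_trans N_bound_gt0).
split=> //.
  rewrite steps_polyE; apply: le_trans N_le _; rewrite lerD2r lerD2l.
  rewrite ler_wpM2l ?mulr_ge0 ?invr_ge0 ?(ltW Rmax_gt0) ?(ltW eps_gt0) //.
  by rewrite lerD2r ler_wpM2l ?mulr_ge0.
have [lo [hi [lo_ge0 hi_le1 lo_hi hi_lo]]] :=
  abs_trans_window M_mdp phi_surj phi_sim.
(* Makes the share of [eps1] in [kap * (t - 1)] equal to [eps - eps / t], less than one [eps]. *)
pose eps1 := eps / (t * nS * Rmax).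
have eps1_gt0 : 0 < eps1 by rewrite divr_gt0 // !mulr_gt0.
pose th := etaT + eps1; pose kap := nS * th * Rmax.
have th_ge0 : 0 <= th by rewrite addr_ge0 // ltW.
have kap_nonneg : 0 <= kap by rewrite !mulr_ge0 // ltW.
(* The loss [kap * (t - 1)] is twice [kap * tri T / t]: once for the optimism of the model, once for
   executing its plan in [M]. *)
pose v := Opt M eps T - kap * (t - 1).
(* One [eps] pays for the sampling error contained in [v]; the other is left for the fluctuations,
   as [2 * lam = N%:R * eps]. *)
have target_le : Opt M eps T - 3 * (abs_error #|Sb| T Rmax etaT etaR / T%:R)
    - 2 * eps <= v - eps.
  have -> : abs_error #|Sb| T Rmax etaT etaR / T%:R =
      etaR + (t - 1) / 2 * (etaT * nS * Rmax).
    by rewrite /abs_error -/t -/nS; field; rewrite gt_eqF.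
  have kapE : kap * (t - 1) = (t - 1) * (etaT * nS * Rmax) + eps - eps / t.
    rewrite /kap /th /eps1; field; rewrite !gt_eqF //.
  have : 0 <= (t - 1) * (etaT * nS * Rmax).
    by rewrite !mulr_ge0 ?subr_ge0 // ltW.
  have : 0 < eps / t by rewrite divr_gt0.
  rewrite /v kapE; lra.
(* If [v] is nonpositive, so is the target, and nonnegative rewards reach it surely. *)
have [v_le0|v_gt0] := leP v 0.
  apply: (@le_trans _ _ 1); first by rewrite lerBlDr lerDl ltW.
  apply: attains_nonpos => //.
  by apply: le_trans target_le _; lra.
have pi_mem : mixing_policies M eps T piopt.
  by split=> //; exists T => //; rewrite leqnn.
have Opt_bnd : Opt M eps T <= t * Rmax / T%:R.
  apply: (Opt_le (s := s0) M_mdp pi_mem) => pi pi_p.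
  by have /andP[] := expected_return_bounds T s0 M_mdp (fun=> pi_p).
have v_le : v + kap * (t - 1) <= Rmax.
  by move: Opt_bnd; rewrite /v subrK -/t mulrAC divff ?mul1r ?gt_eqF.
have opt_acc g : wf_agent M phi Rmax m T g -> accurate M phi m th g ->
    optimistic Rmax m T solve solve_final th v g.
  move=> g_wf g_acc x; have [s phi_s] := phi_surj x.
  have := Opt_le M_mdp pi_mem (fun pi pi_p => restart_value Rmax_gt0 m_gt0
    M_mdp phi_surj th_ge0 solveP solve_finalP g_wf g_acc pi_p phi_s).
  rewrite -/nS -/t -/kap ler_pdivlMr // /v; lra.
have lam_gt0 : 0 < N%:R * eps / 2 by rewrite divr_gt0 // mulr_gt0 ?ltr0n.
have hi_lo_th x a y : hi x a y - lo x a y + eps1 <= th by rewrite lerD2r.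
apply: (attains_bound Rmax_gt0 m_gt0 T_gt0 M_mdp phi_surj rew_phi th_ge0 v_gt0
  v_le eps1_gt0 lo_ge0 hi_le1 lo_hi hi_lo_th lam_gt0 opt_acc s0 N_gt0).
- apply: (@le_trans _ _ (N%:R * (v - eps))); last lra.
  by rewrite ler_wpM2l.
- rewrite !natrM -/nS -/nA -/t -/mR ler_pdivlMr // -ler_pdivrMr //.
  apply: le_trans N_ge; rewrite /N_bound.
  lra.
rewrite -/nS -/nA -/mR -/t [leRHS](splitr delta) lerD //.
  have -> : 2 * nS ^+ 2 * nA * mR / (mR * eps1) ^+ 2 =
      m_bound * (delta / 2) / mR.
    rewrite /eps1 /m_bound; field; rewrite !gt_eqF //.
  by rewrite ler_pdivrMr // mulrC ler_wpM2l // divr_ge0 // ltW.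
have NR_gt0 : 0 < N%:R :> R by rewrite ltr0n.
have -> : N%:R * (8 * t * Rmax) ^+ 2 / (N%:R * eps / 2) ^+ 2 =
    512 * u * (delta / 2) / N%:R.
  rewrite /u; field; rewrite !gt_eqF //.
rewrite ler_pdivrMr // mulrC ler_wpM2l ?divr_ge0 // ?(ltW delta_gt0) //.
apply: le_trans N_ge; rewrite lerDl !mulr_ge0 ?invr_ge0 ?(ltW Rmax_gt0) ?(ltW eps_gt0) //.
by rewrite addr_ge0 // !mulr_ge0.
Qed.
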